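(* Assume the following. (E2) $\mathbf R:\mathbb R^n\to\mathbb R^m$ is continuously differentiable. (E3) $\|J(\mathbf x)-J(\mathbf y)\|\le L\|\mathbf x-\mathbf y\|$ for all $\mathbf x,\mathbf y\in\mathbb R^n$. (E4) There is $\omega>0$ with $\omega\,\mathrm{dist}(\mathbf x,S)\le\|J(\mathbf x)^\top\mathbf R(\mathbf x)\|$ for every $\mathbf x\in B_r$. (E5) There are $\sigma>0$, $\delta\in(0,1]$ with $\|(J(\mathbf x)-J(\bar{\mathbf z}))^\top\mathbf R(\bar{\mathbf z})\|\le\sigma\|\mathbf x-\bar{\mathbf z}\|^{1+\delta}$ for every $\mathbf x\in B_r$ and $\bar{\mathbf z}\in B_r\cap S$. (E6) $\|B(\mathbf x)\|<\lambda_{\min}(P(\mathbf x))$ for every $\mathbf x\in B_r$. Let $\{\mathbf x^k\}_{k=0}^\infty$ be generated by PILM with full steps $\alpha_k=1$, with $\mu_k$ such that $m_\mu\|\mathbf x^k-\bar{\mathbf x}^k\|^\delta\le\mu_k\le M_\mu\|\mathbf x^k-\bar{\mathbf x}^k\|^\delta$ for every $k$, where $0<m_\mu\le M_\mu$, and with $\ell_k$ such that $\rho_k^{\ell_k}\le C_\eta\|\mathbf x^k-\bar{\mathbf x}^k\|^\delta$ for every $k$, for some $C_\eta\ge0$. Let $c_1\ge0$ be a constant such that $\|\mathbf d^k\|\le c_1\,\mathrm{dist}(\mathbf x^k,S)$ for every $k$ with $\mathbf x^k\in B_r$. Put $c_2=L_4c_1^2+L_1L_2(1+c_1)+L_1L_2(1+c_1)^2$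 and $c_3=c_2+\sigma+\sigma(1+c_1)^{1+\delta}+L_3C_\eta+c_1M_\mu$, fix $\nu\in(0,1)$, and assume that $\mathbf x^0\in B(\mathbf x^*,\varepsilon)$ for some $\varepsilon>0$ with $$\varepsilon\le\min\left\{\left(\frac{\omega\nu}{c_3}\right)^{1/\delta},\ \frac{r(1-\nu)}{1+c_1-\nu}\right\}.$$ Then $\mathrm{dist}(\mathbf x^k,S)\to0$ and $\mathbf x^k\to\bar{\mathbf x}$ for some $\bar{\mathbf x}\in S\cap B_r$. The convergence of $\mathrm{dist}(\mathbf x^k,S)$ to $0$ is superlinear if $\delta\in(0,1)$ and quadratic if $\delta=1$.
   Context: Norms are Euclidean 2-norms (spectral norm for matrices); $\lambda_{\min}(A)$ is the smallest absolute value of an eigenvalue of $A$. $\mathbf R=(r_1,\dots,r_m)^\top:\mathbb R^n\to\mathbb R^m$ is a residual map with Jacobian $J(\mathbf x)\in\mathbb R^{m\times n}$, $F=\frac12\|\mathbf R\|^2$, $\mathbf g(\mathbf x)=J(\mathbf x)^\top\mathbf R(\mathbf x)$. Block structure. A partition $I_1,\dots,I_K$ of the variable indices $\{1,\dots,n\}$ is given. $E_s$ is the set of $j$ such that $r_j$ depends only on variables in $I_s$, and $\widehat E=\{1,\dots,m\}\setminus\bigcup_{s}E_s$. Variables and residuals are ordered accordingly: $\mathbf x=(\mathbf x_1,\dots,\mathbf x_K)$, $\mathbf x_s\in\mathbb R^{n_s}$, $\mathbf R(\mathbf x)=(\mathbf R_1(\mathbf x_1),\dots,\mathbf R_K(\mathbf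 x_K),\rho(\mathbf x))$ with $\mathbf R_s=(r_j)_{j\in E_s}$ and $\rho=(r_j)_{j\in\widehat E}$. With $J_{s\mathbf R_s}=\partial\mathbf R_s/\partial\mathbf x_s$ and $J_{s\rho}=\partial\rho/\partial\mathbf x_s$, let $P(\mathbf x)$ be the block diagonal matrix with diagonal blocks $P_s=J_{s\mathbf R_s}^\top J_{s\mathbf R_s}+J_{s\rho}^\top J_{s\rho}$, and $B(\mathbf x)$ the block matrix with zero diagonal blocks and off-diagonal blocks $B_{ij}=J_{i\rho}^\top J_{j\rho}$ ($i\ne j$). Thus $J^\top J=P+B$. A superscript $k$ denotes evaluation at $\mathbf x^k$. PILM with full steps. Given $\mathbf x^k$, $\mu_k>0$ and an integer $\ell_k\ge1$: $\mathbf y^1=-(P^k+\mu_kI)^{-1}\mathbf g^k$, $\mathbf y^{l+1}=-(P^k+\mu_kI)^{-1}(\mathbf g^k+B^k\mathbf y^l)$ for $1\le l\le\ell_k-1$, $\mathbf d^k=\mathbf y^{\ell_k}$, and $\mathbf x^{k+1}=\mathbf x^k+\mathbf d^k$ (step size $\alpha_k=1$). The scalar $\rho_k=\|B^k(P^k+\mu_kI)^{-1}\|$, and $\rho_k^{\ell_k}$ is its $\ell_k$-th power. Local setting. $S=\{\mathbf x\in\mathbb R^n: J(\mathbf x)^\top\mathbf R(\mathbf x)=0\}$; $\mathbf x^*\in S$ is fixed, $B_r=B(\mathbf x^*,r)$ is the open ball with radius $r\in(0,1)$; $\mathrm{dist}(\mathbf x,S)=\min_{\mathbf z\in S}\|\mathbf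 x-\mathbf z\|$ and $\bar{\mathbf x}^k\in S$ is a point with $\|\mathbf x^k-\bar{\mathbf x}^k\|=\mathrm{dist}(\mathbf x^k,S)$. Constants: $R_{\max},L_2\ge0$ satisfy $\|\mathbf R(\mathbf x)\|\le R_{\max}$ and $\|J(\mathbf x)\|\le L_2$ on $B_r$; $L_1=L$ is the Lipschitz constant of $J$; $L_3=L_2^2+L_1R_{\max}$; $L_4=\frac12L_1L_2$. For a nonnegative sequence $a_k\to0$: convergence is superlinear if $a_{k+1}\le\eta_ka_k$ for all $k$ with some $\eta_k\to0$, and quadratic if $a_{k+1}\le Ca_k^2$ for all $k$ with some constant $C$. *)

(* Defs.v *)
From mathcomp Require Import all_boot all_order all_algebra.
From mathcomp Require Import all_classical all_reals all_analysis.

Set Implicit Arguments.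
Unset Strict Implicit.
Unset Printing Implicit Defensive.

Import Order.TTheory GRing.Theory Num.Theory.
Import numFieldNormedType.Exports.

Local Open Scope classical_set_scope.
Local Open Scope ring_scope.

(* The library's norm on matrices is the max norm, so the Euclidean norm and
   the operator norm it induces are defined here. The max and Euclidean norms
   give the same topology, so the library's differentiability, continuity and
   convergence on 'cV[R]_n are the usual ones. *)
Definition enorm (R : realType) (n : nat) (v : 'cV[R]_n) : R :=
  Num.sqrt (\sum_i v i 0 ^+ 2).

Definition spectral_norm (R : realType) (m n : nat) (A : 'M[R]_(m, n)) : R :=
  sup [set enorm (A *m v) | v in [set v : 'cV[R]_n | enorm v <= 1]].

Definition eball (R : realType) (n : nat) (c : 'cV[R]_n) (r : R) :
    set 'cV[R]_n :=
  [set x | enorm (x - c) < r].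

(* A minimum when A is closed and nonempty. *)
Definition edist_to (R : realType) (n : nat) (A : set 'cV[R]_n)
    (x : 'cV[R]_n) : R :=
  inf [set enorm (x - z) | z in A].

(* Only real eigenvalues are considered: the definition is meant for symmetric
   A, which has no others. For such A and n > 0 the set is finite and nonempty,
   so inf is a minimum. *)
Definition lambda_min (R : realType) (n : nat) (A : 'M[R]_n) : R :=
  inf [set `|a| | a in [set a : R | eigenvalue A a]].

Section Residual.
Context {R : realType} {n m : nat}.
Variable res : 'cV[R]_n -> 'cV[R]_m.

(* Column-vector counterpart of the library's jacobian, which acts on row
   vectors and is therefore the transpose of the usual matrix. *)
Definition jac (x : 'cV[R]_n) : 'M[R]_(m, n) :=
  \matrix_(i, j) ('D_(delta_mx j 0) res x) i 0.

Definition continuously_differentiable : Prop :=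
  (forall x, differentiable res x) /\ continuous jac.

Definition grad (x : 'cV[R]_n) : 'cV[R]_n := (jac x)^T *m res x.

Definition crit : set 'cV[R]_n := [set x | grad x = 0].

Definition depends_only_on (I : {set 'I_n}) (e : 'I_m) : Prop :=
  forall x y : 'cV[R]_n,
    (forall i, i \in I -> x i 0 = y i 0) -> res x e 0 = res y e 0.

Definition block_res (I : {set 'I_n}) : {set 'I_m} :=
  finset (fun e => `[< depends_only_on I e >]).

(* The blocks of variables are the members of a partition Pi of 'I_n, in the
   sense of finset; finset.pblock Pi i is the block containing the index i.
   Variables and residuals keep their original order: sorting them by blocks
   only permutes the rows and columns of the matrices below. *)
Variable Pi : {set {set 'I_n}}.

Definition coupling_res : {set 'I_m} :=
  finset (fun e => [forall I in Pi, e \notin block_res I]).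

Definition Pmat (x : 'cV[R]_n) : 'M[R]_n :=
  \matrix_(i, j)
    if j \in finset.pblock Pi i then
      \sum_(e in block_res (finset.pblock Pi i)) jac x e i * jac x e j
      + \sum_(e in coupling_res) jac x e i * jac x e j
    else 0.

Definition Bmat (x : 'cV[R]_n) : 'M[R]_n :=
  \matrix_(i, j)
    if j \in finset.pblock Pi i then 0
    else \sum_(e in coupling_res) jac x e i * jac x e j.

Definition Pinv (x : 'cV[R]_n) (mu : R) : 'M[R]_n :=
  invmx (Pmat x + mu%:M).

(* pilm_dir x mu l is the inner iterate y^l for l >= 1. *)
Definition pilm_dir (x : 'cV[R]_n) (mu : R) (l : nat) : 'cV[R]_n :=
  iter l.-1 (fun y => - (Pinv x mu *m (grad x + Bmat x *m y)))
    (- (Pinv x mu *m grad x)).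

Definition pilm_rho (x : 'cV[R]_n) (mu : R) : R :=
  spectral_norm (Bmat x *m Pinv x mu).

Definition pilm_full_steps (x : nat -> 'cV[R]_n) (mu : nat -> R)
    (ell : nat -> nat) : Prop :=
  forall k, [/\ 0 < mu k, (1 <= ell k)%N
              & x k.+1 = x k + pilm_dir (x k) (mu k) (ell k)].

End Residual.

Definition superlinear (R : realType) (a : nat -> R) : Prop :=
  exists2 eta : nat -> R,
    eta @ \oo --> (0 : R) & forall k, a k.+1 <= eta k * a k.

Definition quadratic (R : realType) (a : nat -> R) : Prop :=
  exists C : R, forall k, a k.+1 <= C * a k ^+ 2.

(* Main.v *)
Require Import Defs.
From mathcomp Require Import all_boot all_order all_algebra.
From mathcomp Require Import all_classical all_reals all_analysis.
From mathcomp Require Import ring lra.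
Import Order.TTheory GRing.Theory Num.Theory.
Import numFieldNormedType.Exports.
Local Open Scope classical_set_scope.
Local Open Scope ring_scope.

(* Write z for the given critical point, J_z and R_z for values at z.
   (E6) at z makes A = J_z^T J_z = P + B injective, so by (E5) z is an isolated
   critical point, and dist(x, S) = |x - z| for x near z; letting x tend to z in
   (E4) then gives A >= omega I.  With u = x^k - z, w = x^(k+1) - z = u + d and
   e = g + (J^T J + mu I) d, for which |e| <= rho^l |g|,
     (mu I + A) w = mu u + e - (J - J_z)^T R_z
                    - J^T ((R - R_z - J_z u) + (J - J_z) d) - (J - J_z)^T J_z w,
   and the bound on eps makes the terms other than mu u at most
   omega nu max(|u|, |w|).  Hence |x^k - z| contracts geometrically as soon as
   |x^0 - z| < eps, and |w| = O(|u|^(1 + delta)).  Comparing with z rather than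
   with the projections of x^k avoids showing that these lie in B_r. *)

Section Auxiliary.
Set Implicit Arguments.
Unset Strict Implicit.
Unset Printing Implicit Defensive.

(** * Euclidean inner product, Euclidean norm and spectral norm *)

Section Euclidean.
Context {R : realType}.

Lemma trmxB m n (A B : 'M[R]_(m, n)) : (A - B)^T = A^T - B^T.
Proof. exact: linearB. Qed.

Lemma trmulmx_diff m n k (A B : 'M[R]_(m, n)) (u v : 'M[R]_(m, k)) :
  A^T *m u - B^T *m v = (A - B)^T *m u + B^T *m (u - v).
Proof. by rewrite trmxB mulmxBl mulmxBr addrA subrK. Qed.

Lemma trmulmx_diffr m n k (A B : 'M[R]_(m, n)) (u v : 'M[R]_(m, k)) :
  A^T *m u - B^T *m v = A^T *m (u - v) + (A - B)^T *m v.
Proof. by rewrite trmxB mulmxBl mulmxBr addrA subrK. Qed.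

Lemma addl_subK (V : zmodType) (x u : V) : x + u - x = u.
Proof. by rewrite addrC addKr. Qed.

Definition dotv (n : nat) (u v : 'cV[R]_n) : R := (u^T *m v) 0 0.

Lemma dotvE n (u v : 'cV[R]_n) : dotv u v = \sum_i u i 0 * v i 0.
Proof. by rewrite /dotv mxE; apply: eq_bigr => i _; rewrite mxE. Qed.

Lemma dotvC n (u v : 'cV[R]_n) : dotv u v = dotv v u.
Proof. by rewrite !dotvE; apply: eq_bigr => i _; rewrite mulrC. Qed.

Lemma dotvDr n (u v w : 'cV[R]_n) : dotv u (v + w) = dotv u v + dotv u w.
Proof. by rewrite /dotv mulmxDr mxE. Qed.

Lemma dotvZr n a (u v : 'cV[R]_n) : dotv u (a *: v) = a * dotv u v.
Proof. by rewrite /dotv -scalemxAr mxE. Qed.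

Lemma dotv0r n (u : 'cV[R]_n) : dotv u 0 = 0.
Proof. by rewrite /dotv mulmx0 mxE. Qed.

Lemma dotvNr n (u v : 'cV[R]_n) : dotv u (- v) = - dotv u v.
Proof. by rewrite -scaleN1r dotvZr mulN1r. Qed.

Lemma dotvBr n (u v w : 'cV[R]_n) : dotv u (v - w) = dotv u v - dotv u w.
Proof. by rewrite dotvDr dotvNr. Qed.

Lemma dotvDl n (u v w : 'cV[R]_n) : dotv (u + v) w = dotv u w + dotv v w.
Proof. by rewrite dotvC dotvDr !(dotvC w). Qed.

Lemma dotvZl n a (u v : 'cV[R]_n) : dotv (a *: u) v = a * dotv u v.
Proof. by rewrite dotvC dotvZr dotvC. Qed.

Lemma dotv_mull m n (A : 'M[R]_(m, n)) u v :
  dotv (A *m u) v = dotv u (A^T *m v).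
Proof. by rewrite /dotv trmx_mul mulmxA. Qed.

Lemma dotv_ge0 n (u : 'cV[R]_n) : 0 <= dotv u u.
Proof. by rewrite dotvE sumr_ge0 // => i _; rewrite -expr2 sqr_ge0. Qed.

Lemma enormE n (u : 'cV[R]_n) : enorm u = Num.sqrt (dotv u u).
Proof. by rewrite /enorm dotvE; congr Num.sqrt; apply: eq_bigr. Qed.

Lemma enorm_sqr n (u : 'cV[R]_n) : enorm u ^+ 2 = dotv u u.
Proof. by rewrite enormE sqr_sqrtr // dotv_ge0. Qed.

Lemma enorm_ge0 n (u : 'cV[R]_n) : 0 <= enorm u.
Proof. exact: sqrtr_ge0. Qed.

Lemma le_enorm_entry n (u : 'cV[R]_n) i : `|u i 0| <= enorm u.
Proof.
rewrite -sqrtr_sqr; apply: ler_wsqrtr; rewrite (bigD1 i) //= lerDl.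
by apply: sumr_ge0 => j _; exact: sqr_ge0.
Qed.

Lemma enorm_eq0 n (u : 'cV[R]_n) : (enorm u == 0) = (u == 0).
Proof.
apply/eqP/eqP => [u0|->]; last first.
  by rewrite enormE dotv0r sqrtr0.
apply/matrixP => i j; rewrite ord1 mxE; apply/eqP.
by rewrite -normr_le0 -u0 le_enorm_entry.
Qed.

Lemma enorm0 n : enorm (0 : 'cV[R]_n) = 0.
Proof. by apply/eqP; rewrite enorm_eq0. Qed.

Lemma enorm_gt0 n (u : 'cV[R]_n) : (0 < enorm u) = (u != 0).
Proof. by rewrite lt_neqAle enorm_ge0 andbT eq_sym enorm_eq0. Qed.

(** Transfers convergence in [enorm] to the topology of column vectors, which comes from the max
    norm. *)
Lemma mx_norm_le_enorm n (u : 'cV[R]_n) : `|u| <= enorm u.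
Proof.
have [->|u0] := eqVneq `|u| 0; first exact: enorm_ge0.
have [i ui] := mx_norm_neq0 u0.
by rewrite [leLHS]ui ord1 le_enorm_entry.
Qed.

Lemma enormZ n a (u : 'cV[R]_n) : enorm (a *: u) = `|a| * enorm u.
Proof.
rewrite enormE dotvZr dotvZl mulrA -expr2 sqrtrM ?sqr_ge0 //.
by rewrite sqrtr_sqr -enormE.
Qed.

Lemma enormN n (u : 'cV[R]_n) : enorm (- u) = enorm u.
Proof. by rewrite -scaleN1r enormZ normrN1 mul1r. Qed.

Lemma enormBC n (u v : 'cV[R]_n) : enorm (u - v) = enorm (v - u).
Proof. by rewrite -opprB enormN. Qed.

(* Cauchy-Schwarz for the semi-inner product of A; A = 1 gives the usual one. *)
Lemma psd_CS n (A : 'M[R]_n) (v w : 'cV[R]_n) :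
  A^T = A -> (forall u, 0 <= dotv u (A *m u)) ->
  dotv v (A *m w) ^+ 2 <= dotv v (A *m v) * dotv w (A *m w).
Proof.
move=> symA psdA.
have E s t : 0 <= s ^+ 2 * dotv v (A *m v) + 2 * s * t * dotv v (A *m w)
                  + t ^+ 2 * dotv w (A *m w).
  have := psdA (s *: v + t *: w).
  rewrite mulmxDr -!scalemxAr !dotvDr !dotvDl !dotvZr !dotvZl.
  rewrite (dotvC w) dotv_mull symA => h; lra.
move: (psdA v) (psdA w) E.
move: (dotv v (A *m v)) (dotv w (A *m w)) (dotv v (A *m w)) => a c b a0 c0 E.
have [c_gt0|c_le0] := ltP 0 c.
  (* With [s = c] and [t = - b] the form equals [c * (a * c - b ^+ 2)]. *)
  have := E c (- b); rewrite -(pmulr_rge0 _ c_gt0) => h.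
  have : 0 <= c * (a * c - b ^+ 2) by rewrite -(pmulr_rge0 _ c_gt0); nra.
  by rewrite pmulr_rge0 // subr_ge0.
have c_eq0 : c = 0 by apply/le_anti; rewrite c_le0.
rewrite c_eq0 in E *; rewrite mulr0.
case: (eqVneq b 0) => [->|b0]; first by rewrite expr0n.
(* If [c = 0] and [b != 0], this [t] makes the form equal to -1. *)
have := E 1 (- (a + 1) / (2 * b)).
have -> : 2 * 1 * (- (a + 1) / (2 * b)) * b = - (a + 1) by field.
by rewrite mulr0 expr1n => ?; lra.
Qed.

Lemma dotv_le n (u v : 'cV[R]_n) : dotv u v <= enorm u * enorm v.
Proof.
apply: le_trans (ler_norm _) _.
rewrite -(ler_pXn2r (_ : 0 < 2)%N) ?nnegrE ?mulr_ge0 ?enorm_ge0 ?normr_ge0 //.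
have := @psd_CS _ 1%:M u v (trmx1 _ _).
rewrite !mul1mx real_normK ?num_real // exprMn !enorm_sqr; apply=> w.
by rewrite mul1mx dotv_ge0.
Qed.

Lemma ler_enormD n (u v : 'cV[R]_n) : enorm (u + v) <= enorm u + enorm v.
Proof.
rewrite -(ler_pXn2r (_ : 0 < 2)%N) ?nnegrE ?addr_ge0 ?enorm_ge0 //.
rewrite sqrrD !enorm_sqr dotvDr !dotvDl (dotvC v u).
by have := dotv_le u v; lra.
Qed.

Lemma ler_enormB n (u v : 'cV[R]_n) : enorm (u - v) <= enorm u + enorm v.
Proof. by apply: le_trans (ler_enormD _ _) _; rewrite enormN. Qed.

(** Cauchy-Schwarz on each row gives the Frobenius norm as [K]. This finite bound makes the [sup] in
    [spectral_norm] a true supremum. *)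
Lemma enorm_mulmx_bounded m n (A : 'M[R]_(m, n)) :
  exists2 K, 0 <= K & forall v, enorm (A *m v) <= K * enorm v.
Proof.
exists (Num.sqrt (\sum_i enorm (row i A)^T ^+ 2)); first exact: sqrtr_ge0.
move=> v; rewrite -(ler_pXn2r (_ : 0 < 2)%N) ?nnegrE ?mulr_ge0 ?enorm_ge0
  ?sqrtr_ge0 //.
have s0 : 0 <= \sum_i enorm (row i A)^T ^+ 2.
  by apply: sumr_ge0 => i _; exact: sqr_ge0.
rewrite exprMn [X in X * _]sqr_sqrtr // [leLHS]enorm_sqr dotvE mulr_suml.
apply: ler_sum => i _.
have -> : (A *m v) i 0 = dotv (row i A)^T v.
  by rewrite dotvE mxE; apply: eq_bigr => j _; rewrite !mxE.
rewrite -expr2 -exprMn -[leLHS]real_normK ?num_real //.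
rewrite ler_pXn2r ?nnegrE ?mulr_ge0 ?enorm_ge0 // ler_norml dotv_le andbT.
by rewrite lerNl -dotvNr (le_trans (dotv_le _ _)) ?enormN.
Qed.

Lemma enorm_mulmx m n (A : 'M[R]_(m, n)) v :
  enorm (A *m v) <= spectral_norm A * enorm v.
Proof.
have [K K0 AK] := enorm_mulmx_bounded A.
have ub : has_ubound [set enorm (A *m v) | v in [set v : 'cV[R]_n | enorm v <= 1]].
  exists K => _ [w /= w1 <-]; apply: le_trans (AK w) _.
  by rewrite ler_piMr.
have [->|v0] := eqVneq v 0; first by rewrite mulmx0 !enorm0 mulr0.
rewrite -enorm_gt0 in v0.
rewrite -ler_pdivrMr //; apply: ub_le_sup => //.
exists ((enorm v)^-1 *: v) => /=.
  by rewrite enormZ ger0_norm ?invr_ge0 ?enorm_ge0 // mulVf ?gt_eqF.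
by rewrite -scalemxAr enormZ ger0_norm ?invr_ge0 ?enorm_ge0 // mulrC.
Qed.

Lemma spectral_norm_ge0 m n (A : 'M[R]_(m, n)) : 0 <= spectral_norm A.
Proof.
have [K K0 AK] := enorm_mulmx_bounded A.
apply: ub_le_sup; last by exists 0; rewrite /= ?mulmx0 ?enorm0.
exists K => _ [w /= w1 <-]; apply: le_trans (AK w) _.
by rewrite ler_piMr.
Qed.

Lemma enorm_mulmx_le m n (A : 'M[R]_(m, n)) v K c :
  spectral_norm A <= K -> enorm v <= c -> enorm (A *m v) <= K * c.
Proof.
move=> AK vc; apply: le_trans (enorm_mulmx A v) _.
by apply: ler_pM => //; rewrite ?spectral_norm_ge0 ?enorm_ge0.
Qed.

(** The transpose inherits the bound of [A] because |A^T v|^2 = <v, A A^T v> <= |v| K |A^T v|. *)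
Lemma enorm_trmulmx_le m n (A : 'M[R]_(m, n)) v K c :
  spectral_norm A <= K -> enorm v <= c -> enorm (A^T *m v) <= K * c.
Proof.
move=> AK vc.
have K0 : 0 <= K by apply: le_trans AK; exact: spectral_norm_ge0.
have [->|v0] := eqVneq (A^T *m v) 0.
  by rewrite enorm0 mulr_ge0 // (le_trans _ vc) ?enorm_ge0.
rewrite -enorm_gt0 in v0; rewrite -(ler_pM2r v0) -expr2 enorm_sqr.
rewrite dotv_mull trmxK; apply: le_trans (dotv_le _ _) _.
rewrite mulrAC mulrC; apply: ler_pM; rewrite ?enorm_ge0 //.
exact: enorm_mulmx_le.
Qed.

Lemma enorm_segment n (u : 'cV[R]_n) (t : R) : 0 <= t <= 1 -> enorm (t *: u) <= enorm u.
Proof. by case/andP => t0 t1; rewrite enormZ ger0_norm // ler_piMl ?enorm_ge0. Qed.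

(** Vector differences are bounded by testing them against themselves, so that a mean value theorem
    for scalar functions suffices. *)
Lemma enorm_le_of_dotv n (q : 'cV[R]_n) c :
  0 <= c -> dotv q q <= enorm q * c -> enorm q <= c.
Proof.
move=> c0; rewrite -enorm_sqr expr2.
have [->|q0] := eqVneq q 0; first by rewrite enorm0.
by rewrite ler_pM2l ?enorm_gt0.
Qed.

Lemma col_neq0_dim n (u : 'cV[R]_n) : u != 0 -> (0 < n)%N.
Proof.
rewrite lt0n; apply: contra => /eqP n0; apply/eqP/matrixP => i.
by have := ltn_ord i; rewrite [X in (_ < X)%N]n0.
Qed.

End Euclidean.

(** * Smallest eigenvalue and regularisation of a positive semidefinite matrix *)

Section PSD.
Context {R : realType}.

(* lam is the infimum of the Rayleigh quotient. If B = A - lam I were invertible,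
   |B v|^2 <= K <v, B v> would bound <v, B v> away from 0 on the unit sphere, so
   no compactness argument is needed. *)
Lemma psd_min_eigenvalue n (A : 'M[R]_n) :
  (0 < n)%N -> A^T = A -> (forall v, 0 <= dotv v (A *m v)) ->
  exists lam, [/\ eigenvalue A lam, 0 <= lam
    & forall v, lam * dotv v v <= dotv v (A *m v)].
Proof.
case: n A => // n A _ symA psdA.
pose S := [set dotv v (A *m v) | v in [set v : 'cV[R]_n.+1 | enorm v = 1]].
have unit_scale (v : 'cV[R]_n.+1) : v != 0 -> enorm ((enorm v)^-1 *: v) = 1.
  rewrite -enorm_gt0 => v0.
  by rewrite enormZ ger0_norm ?invr_ge0 ?enorm_ge0 // mulVf ?gt_eqF.
have S0 : S !=set0.
  have e0 : delta_mx 0 0 != 0 :> 'cV[R]_n.+1.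
    apply/eqP => /matrixP/(_ 0 0)/eqP.
    by rewrite !mxE !eqxx oner_eq0.
  pose e : 'cV[R]_n.+1 := delta_mx 0 0; pose w := (enorm e)^-1 *: e.
  by exists (dotv w (A *m w)); exists w => //; exact: unit_scale.
have lbS : lbound S 0 by move=> _ [v _ <-]; exact: psdA.
have hasS : has_inf S by split=> //; exists 0.
pose lam := inf S.
have lamP v : lam * dotv v v <= dotv v (A *m v).
  have [->|v0] := eqVneq v 0.
    by rewrite mulmx0 !dotv0r mulr0.
  have : lam <= dotv ((enorm v)^-1 *: v) (A *m ((enorm v)^-1 *: v)).
    by apply: ge_inf; [exists 0|exists ((enorm v)^-1 *: v) => //; exact: unit_scale].
  rewrite -scalemxAr dotvZl dotvZr mulrA -expr2 exprVn enorm_sqr mulrC.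
  by rewrite ler_pdivlMr // -enorm_sqr exprn_gt0 ?enorm_gt0.
exists lam; split=> //; last exact: lb_le_inf.
apply: contrapT => /negP; rewrite /eigenvalue /eigenspace negbK kermx_eq0.
rewrite row_free_unit => Bu.
set B := A - lam%:M in Bu.
have symB : B^T = B by rewrite /B linearB /= symA tr_scalar_mx.
have BE v : dotv v (B *m v) = dotv v (A *m v) - lam * dotv v v.
  by rewrite mulmxBl dotvBr mul_scalar_mx dotvZr.
have psdB v : 0 <= dotv v (B *m v) by rewrite BE subr_ge0.
have [K K0 BK] := enorm_mulmx_bounded B.
have [K' K'0 BK'] := enorm_mulmx_bounded (invmx B).
have small v : enorm v = 1 -> 1 <= K' ^+ 2 * K * dotv v (B *m v).
  move=> v1; have := BK' (B *m v); rewrite mulKmx // v1 => h1.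
  have y0 : 0 < enorm (B *m v).
    rewrite lt_neqAle enorm_ge0 andbT; apply/eqP => y0.
    by move: h1; rewrite -y0 mulr0 ler10.
  have h2 : enorm (B *m v) ^+ 2 <= K * dotv v (B *m v).
    (* The form of [B] at v and B v gives |B v|^4 <= <v, B v> <B v, B B v>, and the last factor is
       at most K |B v|^2. *)
    have := psd_CS v (B *m v) symB psdB.
    rewrite -{1}symB -dotv_mull -enorm_sqr => h.
    have {}h : (enorm (B *m v) ^+ 2) ^+ 2
        <= dotv v (B *m v) * (enorm (B *m v) * (K * enorm (B *m v))).
      apply: le_trans h _; apply: ler_wpM2l => //.
      apply: le_trans (dotv_le _ _) _; apply: ler_wpM2l; rewrite ?enorm_ge0 //.
    have e2 : 0 < enorm (B *m v) ^+ 2 by rewrite exprn_gt0.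
    by rewrite -(ler_pM2l e2); lra.
  have : K' ^+ 2 * enorm (B *m v) ^+ 2 <= K' ^+ 2 * (K * dotv v (B *m v)).
    by apply: ler_wpM2l; rewrite ?sqr_ge0.
  rewrite -mulrA => /(le_trans _); apply.
  by rewrite -exprMn -[leLHS](expr1n _ 2) ler_pXn2r ?nnegrE ?mulr_ge0 ?enorm_ge0.
(* By [small], every Rayleigh quotient exceeds [lam] by at least [c], against the choice of [lam] as
   infimum. The added 1 keeps the denominator positive. *)
pose c := (K' ^+ 2 * K + 1)^-1.
have c0 : 0 < K' ^+ 2 * K + 1 by rewrite ltr_wpDl ?mulr_ge0 ?sqr_ge0.
suff : lam + c <= lam by rewrite gerDl leNgt invr_gt0 c0.
apply: lb_le_inf => // _ [v /= v1 <-].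
have := small v v1; have := psdB v; have := BE v.
rewrite -(enorm_sqr v) v1 expr1n mulr1 -lerBrDl => -> h0 h1.
rewrite /c -[leLHS]mul1r ler_pdivrMr //; apply: le_trans h1 _.
by rewrite [leRHS]mulrC ler_wpM2r // lerDl.
Qed.

(** A kernel vector u gives <u, A u> + mu |u|^2 = 0, a sum of nonnegative terms. *)
Lemma psd_addmu_unit n (A : 'M[R]_n) mu :
  0 < mu -> (forall v, 0 <= dotv v (A *m v)) -> A + mu%:M \in unitmx.
Proof.
move=> mu0 psdA; rewrite -unitmx_tr -row_free_unit -kermx_eq0.
apply/eqP/row_matrixP => i; rewrite row0.
set u := row i _; have : u *m (A + mu%:M)^T = 0.
  by rewrite -row_mul mulmx_ker row0.
move/(congr1 trmx); rewrite trmx_mul trmxK trmx0 mulmxDl mul_scalar_mx => h.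
have {}h := congr1 (dotv u^T) h; rewrite dotvDr dotvZr dotv0r in h.
have : dotv u^T u^T <= 0.
  by rewrite -(pmulr_rle0 _ mu0); have := psdA u^T; lra.
rewrite -enorm_sqr => h2; apply: trmx_inj; rewrite trmx0; apply/eqP.
have : enorm u^T ^+ 2 == 0 by rewrite eq_le h2 sqr_ge0.
by rewrite sqrf_eq0 enorm_eq0.
Qed.

End PSD.

(** * Block structure of the Jacobian and the splitting J^T J = P + B *)

Section Residual.
Context {R : realType} {n m : nat}.
Variable res : 'cV[R]_n -> 'cV[R]_m.

(** Moving along the i-th axis leaves residual [e] constant, so its difference quotients vanish. *)
Lemma jac_depends_only_on x I e i :
  differentiable res x -> depends_only_on res I e -> i \notin I ->
  jac res x e i = 0.
Proof.
move=> dres dep iI.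
rewrite mxE derive_mx; last exact: diff_derivable.
rewrite mxE /derive; apply: norm_cvg_lim => //.
apply: cvg_near_cst; near=> h.
rewrite [X in _ *: X](_ : _ = 0) ?scaler0 //=.
apply/eqP; rewrite subr_eq0; apply/eqP; apply: dep => j jI.
rewrite !mxE; case: eqVneq => [ji|]; last by rewrite mulr0 add0r.
by move: iI; rewrite -ji jI.
Unshelve. all: by end_near.
Qed.

Variable Pi : {set {set 'I_n}}.
Hypothesis hPi : finset.partition Pi [set: 'I_n]%SET.

Let coverPi i : i \in finset.cover Pi.
Proof. by rewrite (finset.cover_partition hPi) finset.in_setT. Qed.

Let trivPi : finset.trivIset Pi.
Proof. by case/and3P: hPi. Qed.

Let mem_pblockE i j :
  (j \in finset.pblock Pi i) = (finset.pblock Pi i == finset.pblock Pi j).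
Proof. by rewrite finset.eq_pblock. Qed.

Lemma trmx_Pmat x : (Pmat res Pi x)^T = Pmat res Pi x.
Proof.
apply/matrixP => i j; rewrite !mxE !mem_pblockE eq_sym.
case: eqP => // ->; congr (_ + _); apply: eq_bigr => e _; exact: mulrC.
Qed.

(** The quadratic form is the sum, over blocks I and residuals e, of the nonnegative weight [q I e]
    times the square of the sum of J_ei v_i over i in I. *)
Lemma Pmat_psd x v : 0 <= dotv v (Pmat res Pi x *m v).
Proof.
rewrite dotvE.
pose q I e : R := (e \in block_res res I)%:R + (e \in coupling_res res Pi)%:R.
have PE i j : Pmat res Pi x i j = if finset.pblock Pi i == finset.pblock Pi j
    then \sum_e q (finset.pblock Pi i) e * (jac res x e i * jac res x e j)
    else 0.
  rewrite mxE mem_pblockE; case: ifP => // _.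
  rewrite big_mkcond [X in _ + X]big_mkcond -big_split; apply: eq_bigr => e _ /=.
  by rewrite /q mulrDl; do 2 case: ifP => _; rewrite ?mul1r ?mul0r.
rewrite (partition_big (finset.pblock Pi) xpredT) //=; apply: sumr_ge0 => I _.
rewrite (_ : \sum_(_ | _) _ = \sum_e q I e *
  (\sum_(i | finset.pblock Pi i == I) jac res x e i * v i 0) ^+ 2).
  by apply: sumr_ge0 => e _; rewrite mulr_ge0 ?sqr_ge0 // /q addr_ge0 ?ler0n.
under [RHS]eq_bigr => e _.
  rewrite expr2 big_distrlr mulr_sumr.
  under eq_bigr => i _ do rewrite mulr_sumr.
  over.
rewrite exchange_big /=; apply: eq_bigr => i /eqP iI.
rewrite exchange_big /= mxE mulr_sumr [RHS]big_mkcond /=.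
apply: eq_bigr => j _; rewrite PE iI eq_sym; case: eqP => _; last first.
  by rewrite mul0r mulr0.
rewrite mulr_suml mulr_sumr; apply: eq_bigr => e _.
by ring.
Qed.

(** A residual outside [coupling_res] belongs to some block, and its Jacobian row vanishes off that
    block. It can thus contribute to the entry (i, j) only when this block contains both i and j. *)
Lemma jacTjacE x : differentiable res x ->
  (jac res x)^T *m jac res x = Pmat res Pi x + Bmat res Pi x.
Proof.
move=> dres; apply/matrixP => i j.
have J0 I e k : e \in block_res res I -> k \notin I -> jac res x e k = 0.
  by rewrite finset.inE => /asboolP; exact: jac_depends_only_on.
rewrite [RHS]mxE [X in X + _]mxE [X in _ + X]mxE [LHS]mxE.
under eq_bigr do rewrite [(jac res x)^T _ _]mxE.
rewrite (bigID (mem (coupling_res res Pi))) /=.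
have uncoupled e : e \notin coupling_res res Pi ->
    exists2 I, I \in Pi & e \in block_res res I.
  rewrite finset.inE => /forall_inPn[I IPi]; rewrite negbK => eI.
  by exists I.
case: ifP => ij; last first.
  rewrite add0r [X in _ + X]big1 ?addr0 // => e /uncoupled[I IPi eI].
  have [iI|iI] := boolP (i \in I); last by rewrite (J0 _ _ _ eI iI) mul0r.
  rewrite (J0 _ _ j eI) ?mulr0 //; apply: contraFN ij => jI.
  by rewrite (finset.def_pblock trivPi IPi iI).
rewrite addr0 addrC; congr (_ + _).
set I := finset.pblock Pi i.
have IPi : I \in Pi by exact: finset.pblock_mem.
have iI : i \in I by rewrite finset.mem_pblock.
(* Uncoupled residuals outside [block_res res I] depend only on a block other than [I], so their
   derivative in direction i vanishes. *)
rewrite (bigID (mem (block_res res I))) /= [X in _ + X]big1 ?addr0.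
  apply: eq_bigl => e; rewrite andb_idl // => eI.
  rewrite finset.inE negb_forall_in; apply/exists_inP.
  by exists I => //; rewrite negbK.
move=> e /andP[/uncoupled[I' I'Pi eI'] eI].
rewrite (J0 _ _ i eI') ?mul0r //; apply: contra eI => iI'.
by rewrite /I (finset.def_pblock trivPi I'Pi iI').
Qed.

End Residual.

(** * Mean value theorem along a segment *)

Section MeanValue.
Context {R : realType} {n m : nat}.
Variable res : 'cV[R]_n -> 'cV[R]_m.

Lemma diff_jacE x v : differentiable res x -> 'd res x v = jac res x *m v.
Proof.
move=> dres; rewrite {1}(matrix_sum_delta v) linear_sum.
apply/matrixP => i j; rewrite ord1 summxE mxE; apply: eq_bigr => k _.
by rewrite big_ord1 linearZ /= -deriveE // !mxE mulrC.
Qed.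

(** The scalar function <q, res (x + t u)> of t has derivative <q, J(x + t u) u>, so the
    one-variable theorem applies. The point [t] depends on [q], which later is the difference to be
    bounded. *)
Lemma residual_mean_value q (x u : 'cV[R]_n) : (forall y, differentiable res y) ->
  exists2 t : R, 0 <= t <= 1 &
    dotv q (res (x + u) - res x) = dotv q (jac res (x + t *: u) *m u).
Proof.
move=> dres; pose g t := res (x + t *: u); pose f t := dotv q (g t).
have dg (t : R) : is_diff t g (fun s => jac res (x + t *: u) *m (s *: u)).
  have dl : is_diff t (cst x + ( *:%R^~ u)) ( *:%R^~ u).
    apply: (is_diff_eq (is_diffD (is_diff_cst x t) (is_diff_scalel t u))).
    exact: add0r.
  have dr : is_diff (x + t *: u) res ('d res (x + t *: u)) by exact: DiffDef.
  have := @is_diff_comp _ _ _ _ _ _ _ _ t dl dr.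
  move/is_diff_eq; apply.
  by apply/funext => s /=; rewrite diff_jacE.
have df (t : R) : is_derive t 1 f (dotv q (jac res (x + t *: u) *m u)).
  have gt : derivable g t 1 by exact: diff_derivable.
  have gi i : is_derive t 1 (fun s => g s i 0) ((jac res (x + t *: u) *m u) i 0).
    apply: DeriveDef; first by move/derivable_mxP : gt; exact.
    have := congr1 (fun M : 'cV[R]_m => M i 0) (derive_mx gt); rewrite mxE => <-.
    by rewrite deriveE // diff_val scale1r.
  have -> : f = \sum_i (fun s => q i 0 * g s i 0).
    by apply/funext => s; rewrite /f dotvE fct_sumE.
  by rewrite dotvE; apply: is_derive_sum.
have cf : {within `[0, 1], continuous f}.
  apply: continuous_subspaceT => t.
  by apply/differentiable_continuous/derivable1_diffP; exact: ex_derive.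
have [t] := MVT_segment ler01 (fun t _ => df t) cf.
rewrite in_itv /= => t01 ft; exists t => //.
rewrite (subr0 (1 : R)) (mulr1 (dotv _ _)) in ft.
by rewrite -ft dotvBr /f /g scale1r scale0r addr0.
Qed.

End MeanValue.

(** * Residual of the inner iteration and the identity behind one step *)

Section StepAlgebra.
Context {R : realType}.

(** Each pass multiplies the residual g + (A + B) y by - B A^(-1), and at y = 0 this residual is
    g. *)
Lemma iter_residual_le n (A B : 'M[R]_n) (g : 'cV[R]_n) l : A \in unitmx ->
  let d := iter l (fun y => - (invmx A *m (g + B *m y))) 0 in
  enorm (g + (A *m d + B *m d))
    <= spectral_norm (B *m invmx A) ^+ l * enorm g.
Proof.
move=> Au; elim: l => [|l IH] /=.
  by rewrite !mulmx0 !addr0 expr0 mul1r.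
set y := iter _ _ _ in IH *.
move zE : (g + B *m y) => z.
have -> : g + (A *m - (invmx A *m z) + B *m - (invmx A *m z))
    = - (B *m invmx A *m (g + (A *m y + B *m y))).
  rewrite [g + (A *m y + _)]addrCA zE mulmxDr !mulmxN mulKVmx // -!mulmxA.
  rewrite mulKmx // -zE; apply/matrixP => i j; rewrite !mxE; ring.
rewrite enormN exprS -mulrA.
by apply: le_trans (enorm_mulmx _ _) _; rewrite ler_wpM2l ?spectral_norm_ge0.
Qed.

(** In the application [Js] is the Jacobian at the critical point z, [p] is R - R_z and [s] is (J -
    Js)^T R_z, so that J^T p + s is the gradient. *)
Lemma step_identity n m (J Js : 'M[R]_(m, n)) (mu : R) p u d s :
  mu *: (u + d) + Js^T *m Js *m (u + d) =
  mu *: u + (J^T *m p + s + (J^T *m J *m d + mu *: d)) - s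
  - J^T *m (p - Js *m u + (J - Js) *m d) - (J - Js)^T *m (Js *m (u + d))
  :> 'cV[R]_n.
Proof.
rewrite trmxB !(mulmxDr, mulmxBl, mulmxN, mulmxBr, scalerDr) !mulmxA.
by apply/matrixP => i j; rewrite !mxE; ring.
Qed.

End StepAlgebra.

(** * Real powers, the contraction factor and convergence rates *)

Section PowerAndRates.
Context {R : realType}.

Lemma powR_small (delta e : R) : 0 < delta -> 0 < e ->
  exists2 tau, 0 < tau & forall a, 0 <= a <= tau -> a `^ delta <= e.
Proof.
move=> d0 e0; exists (e `^ delta^-1); first exact: powR_gt0.
move=> a /andP[a0 ae]; rewrite -[leRHS](powRr1 (ltW e0)).
rewrite -(mulVf (lt0r_neq0 d0)) powRrM.
by apply: ge0_ler_powR; rewrite ?nnegrE ?powR_ge0 ?(ltW d0).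
Qed.

Lemma powR1D (delta a : R) : 0 < delta -> 0 <= a ->
  a `^ (1 + delta) = a * a `^ delta.
Proof.
move=> d0 a0; rewrite powRD ?powRr1 //.
by apply/implyP => /eqP; lra.
Qed.

Lemma ler_powR_self (delta a : R) : delta <= 1 -> 0 <= a <= 1 -> a <= a `^ delta.
Proof.
move=> d1 /andP[a0 a1]; have [->|an0] := eqVneq a 0; first exact: powR_ge0.
by apply: ger1_powR => //; rewrite lt_neqAle eq_sym an0 a0.
Qed.

(** Moving [s2 * b] to the left leaves at least mu + s1 + (1 - nu) omega as coefficient of [b]. The
    ratio t / (t + (1 - nu) omega) increases with t, so mu + s1 <= M + omega yields a factor that
    depends neither on [mu] nor on [s1]. The second bound keeps mu + s1, which gives the rate. *)
Lemma contraction_of_bound (omega nu M mu s1 s2 a b : R) :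
  0 < omega -> 0 < nu < 1 -> 0 <= a -> 0 <= b -> 0 <= s1 -> 0 <= s2 ->
  0 < mu -> mu <= M -> s1 + s2 <= omega * nu ->
  (mu + omega) * b <= (mu + s1) * a + s2 * b ->
  b <= (M + omega) / (M + omega + (1 - nu) * omega) * a /\
  (1 - nu) * omega * b <= (mu + s1) * a.
Proof.
move=> om0 /andP[nu0 nu1] a0 b0 s10 s20 mu0 muM s12 h.
have c0 : 0 < (1 - nu) * omega by rewrite mulr_gt0 ?subr_gt0.
have h1 : (mu + s1 + (1 - nu) * omega) * b <= (mu + s1) * a.
  apply: (@le_trans _ _ ((mu + omega - s2) * b)); last by lra.
  by apply: ler_wpM2r => //; lra.
split; last first.
  by apply: le_trans h1; apply: ler_wpM2r => //; rewrite lerDr; lra.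
have e0 : 0 < mu + s1 by rewrite ltr_pwDl.
have D0 : 0 < mu + s1 + (1 - nu) * omega by exact: addr_gt0.
have D1 : 0 < M + omega + (1 - nu) * omega by lra.
have M0 : mu + s1 <= M + omega.
  by rewrite lerD // (le_trans _ (ler_piMr _ (ltW nu1))) ?(ltW om0) //; lra.
apply: (@le_trans _ _ ((mu + s1) / (mu + s1 + (1 - nu) * omega) * a)).
  by rewrite mulrAC ler_pdivlMr // mulrC.
apply: ler_wpM2r => //; rewrite ler_pdivrMr // mulrAC ler_pdivlMr //.
by have := ler_wpM2r (ltW c0) M0; lra.
Qed.

(** With the exact ratios as [eta] the inequality holds at every index, early ones included; the
    eventual bound forces these ratios to 0. *)
Lemma superlinear_of_eventual (delta C : R) (h : nat -> R) :
  0 < delta -> 0 <= C -> (forall k, 0 < h k) -> h @ \oo --> (0 : R) ->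
  (\forall k \near \oo, h k.+1 <= C * h k `^ delta * h k) ->
  superlinear h.
Proof.
move=> d0 C0 h0 hcv hC; exists (fun k => h k.+1 / h k); last first.
  by move=> k; rewrite divfK // gt_eqF.
apply/cvgr0Pnorm_le => e e0.
have e'0 : 0 < e / (C + 1) by rewrite divr_gt0 // ltr_wpDl.
have [tau tau0 tauP] := powR_small d0 e'0.
near=> k.
have htau : h k <= tau.
  rewrite (le_trans (ler_norm _)) //; near: k.
  exact: cvgr0_norm_le hcv _ tau0.
rewrite gtr0_norm ?divr_gt0 // ler_pdivrMr //.
apply: (@le_trans _ _ (C * h k `^ delta * h k)); first by near: k.
apply: ler_wpM2r; first exact: ltW.
apply: (@le_trans _ _ (C * (e / (C + 1)))).
  by rewrite ler_wpM2l // tauP // htau ltW.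
by rewrite mulrCA ler_piMr ?ltW // ltr_pdivrMr ?ltr_wpDl // mul1r ltrDl.
Unshelve. all: by end_near.
Qed.

(** The finitely many early ratios are added to the constant. *)
Lemma quadratic_of_eventual (C : R) (h : nat -> R) :
  0 <= C -> (forall k, 0 < h k) ->
  (\forall k \near \oo, h k.+1 <= C * h k ^+ 2) -> quadratic h.
Proof.
move=> C0 h0 [N _ hN].
have q0 k : 0 <= h k.+1 / h k ^+ 2 by rewrite divr_ge0 ?sqr_ge0 // ltW.
exists (C + \sum_(k < N) h k.+1 / h k ^+ 2) => k.
rewrite mulrDl; have [kN|Nk] := ltnP k N; last first.
  apply: le_trans (hN k Nk) _.
  by rewrite lerDl mulr_ge0 ?sqr_ge0 // sumr_ge0.
rewrite (bigD1 (Ordinal kN)) //= mulrDl divfK ?sqrf_eq0 ?gt_eqF //.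
by rewrite addrCA lerDl addr_ge0 // mulr_ge0 ?sqr_ge0 // sumr_ge0.
Qed.

End PowerAndRates.

(** * Local analysis at a nondegenerate critical point *)

Section CriticalPoint.
Context {R : realType} {n m : nat}.

Variable res : 'cV[R]_n -> 'cV[R]_m.
Variables (xs : 'cV[R]_n) (r Rmax L L2 sigma delta omega : R).
Hypothesis dres : forall y, differentiable res y.
Hypothesis crit_xs : crit res xs.
Hypothesis L_ge0 : 0 <= L.
Hypothesis L2_ge0 : 0 <= L2.
Hypothesis sigma_ge0 : 0 <= sigma.
Hypotheses (delta_gt0 : 0 < delta) (delta_le1 : delta <= 1).
Hypotheses (r_gt0 : 0 < r) (r_lt1 : r < 1).
Hypothesis resRmax : forall x, eball xs r x -> enorm (res x) <= Rmax.
Hypothesis jacL2 : forall x, eball xs r x -> spectral_norm (jac res x) <= L2.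
Hypothesis jac_lip : forall x y : 'cV[R]_n,
  spectral_norm (jac res x - jac res y) <= L * enorm (x - y).
Hypothesis jac_sigma : forall x z, eball xs r x -> eball xs r z ->
  crit res z ->
  enorm ((jac res x - jac res z)^T *m res z) <= sigma * enorm (x - z) `^ (1 + delta).

Let Js := jac res xs.

Lemma ball_xs : eball xs r xs.
Proof. by rewrite /eball /= subrr enorm0. Qed.

Lemma ball_add u : enorm u < r -> eball xs r (xs + u).
Proof. by rewrite /eball /= addl_subK. Qed.

Lemma jac_lip_xs u : spectral_norm (jac res (xs + u) - Js) <= L * enorm u.
Proof. by have := jac_lip (xs + u) xs; rewrite addl_subK. Qed.

Lemma res_lip u : enorm u < r -> enorm (res (xs + u) - res xs) <= L2 * enorm u.
Proof.
move=> ur; apply: enorm_le_of_dotv; first by rewrite mulr_ge0 ?enorm_ge0.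
have [t t01 ->] := residual_mean_value (res (xs + u) - res xs) xs u dres.
apply: le_trans (dotv_le _ _) _; apply: ler_wpM2l; first exact: enorm_ge0.
apply: enorm_mulmx_le => //; apply: jacL2; apply: ball_add.
exact: le_lt_trans (enorm_segment _ t01) ur.
Qed.

(** A single intermediate point gives the factor L instead of L / 2; the constant [c3] of the
    theorem has room for it. *)
Lemma res_taylor u :
  enorm (res (xs + u) - res xs - Js *m u) <= L * enorm u ^+ 2.
Proof.
apply: enorm_le_of_dotv; first by rewrite mulr_ge0 ?exprn_ge0 ?enorm_ge0.
set q := _ - Js *m u.
have [t t01 E] := residual_mean_value q xs u dres.
rewrite {2}/q dotvBr E -dotvBr -mulmxBl.
apply: le_trans (dotv_le _ _) _; apply: ler_wpM2l; first exact: enorm_ge0.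
rewrite expr2 mulrA; apply: enorm_mulmx_le => //.
apply: le_trans (jac_lip_xs _) _; apply: ler_wpM2l => //.
exact: enorm_segment.
Qed.

Lemma grad_splitE x :
  grad res x = (jac res x)^T *m (res x - res xs) + (jac res x - Js)^T *m res xs.
Proof.
have <- := trmulmx_diffr (jac res x) Js (res x) (res xs).
by rewrite [X in _ - X](crit_xs : Js^T *m res xs = 0) subr0.
Qed.

Lemma enorm_grad_le u : enorm u < r ->
  enorm (grad res (xs + u)) <= (L2 ^+ 2 + L * Rmax) * enorm u.
Proof.
move=> ur; rewrite grad_splitE mulrDl.
apply: le_trans (ler_enormD _ _) _; apply: lerD.
  rewrite expr2 -mulrA; apply: enorm_trmulmx_le (res_lip ur).
  exact/jacL2/ball_add.
rewrite mulrAC; apply: enorm_trmulmx_le (jac_lip_xs u) _.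
exact: resRmax ball_xs.
Qed.

Lemma jac_sigma_xs u : enorm u < r ->
  enorm ((jac res (xs + u) - Js)^T *m res xs) <= sigma * (enorm u * enorm u `^ delta).
Proof.
move=> ur; have := jac_sigma (ball_add ur) ball_xs crit_xs.
by rewrite addl_subK powR1D ?enorm_ge0.
Qed.

(** (E5) bounds the curvature term that Js^T Js omits, and |u| < 1 allows |u|^2 to be absorbed into
    |u|^(1 + delta). *)
Lemma grad_taylor u : enorm u < r ->
  enorm (grad res (xs + u) - Js^T *m Js *m u)
    <= (2 * L * L2 + sigma) * (enorm u * enorm u `^ delta).
Proof.
move=> ur; rewrite grad_splitE addrAC -mulmxA trmulmx_diff.
set J := jac res _; set q := res _ - _.
rewrite mulrDl; apply: le_trans (ler_enormD _ _) (lerD _ (jac_sigma_xs ur)).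
apply: (@le_trans _ _ (2 * L * L2 * (enorm u * enorm u))); last first.
  rewrite !ler_wpM2l ?mulr_ge0 ?enorm_ge0 // ler_powR_self // enorm_ge0.
  exact/ltW/(lt_trans ur).
apply: le_trans (ler_enormD _ _) _.
have := enorm_trmulmx_le (jac_lip_xs u) (res_lip ur).
have := enorm_trmulmx_le (jacL2 ball_xs) (res_taylor u).
rewrite -/J -/q -/Js; set a := enorm _; set b := enorm (_ *m q); lra.
Qed.

Hypothesis nondeg : forall v : 'cV[R]_n, Js^T *m Js *m v = 0 -> v = 0.

(** At a critical point xs + u, [grad_taylor] and the inverse of Js^T Js give |u| <= C |u|^delta
    |u|, which is impossible for u nonzero with C |u|^delta < 1. *)
Lemma crit_isolated :
  exists2 tau, 0 < tau & forall z, crit res z -> enorm (z - xs) < tau -> z = xs.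
Proof.
have Au : Js^T *m Js \in unitmx.
  rewrite -unitmx_tr -row_free_unit -kermx_eq0.
  apply/eqP/row_matrixP => i; rewrite row0; apply: trmx_inj; rewrite trmx0.
  apply: nondeg; rewrite -[LHS]trmxK trmx_mul trmxK -row_mul mulmx_ker.
  by rewrite row0 trmx0.
have [K K0 AK] := enorm_mulmx_bounded (invmx (Js^T *m Js)).
pose C := K * (2 * L * L2 + sigma).
have C0 : 0 <= C by rewrite !(mulr_ge0, addr_ge0).
have e0 : 0 < (C + 1)^-1 by rewrite invr_gt0 ltr_wpDl.
have [tau tau0 tauP] := powR_small delta_gt0 e0.
exists (Num.min r tau); first by rewrite lt_min r_gt0.
move=> z; rewrite lt_min => gz /andP[zr ztau].
apply/eqP; rewrite -subr_eq0; apply: contraT => zn.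
set u := z - xs in zr ztau zn *.
have zE : z = xs + u by rewrite /u addrC subrK.
have := grad_taylor zr; rewrite -zE gz sub0r enormN => h.
have := AK (Js^T *m Js *m u); rewrite mulKmx // => h2.
have : enorm u <= C * enorm u `^ delta * enorm u.
  apply: le_trans h2 _; rewrite /C -mulrA -[K * _ * _]mulrA.
  apply: ler_wpM2l => //.
  by rewrite [_ `^ _ * _]mulrC.
rewrite -[leLHS]mul1r ler_pM2r ?enorm_gt0 // leNgt => /negP[].
have := tauP (enorm u); rewrite enorm_ge0 ltW // => /(_ isT) h3.
apply: (@le_lt_trans _ _ (C * (C + 1)^-1)); first exact: ler_wpM2l.
by rewrite ltr_pdivrMr ?mul1r ?ltrDl // ltr_wpDl.
Qed.

Lemma edist_to_xs_le x : edist_to (crit res) x <= enorm (x - xs).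
Proof.
apply: ge_inf; last by exists xs.
by exists 0 => _ [z _ <-]; exact: enorm_ge0.
Qed.

Lemma edist_to_xs_near : exists2 tau, 0 < tau & forall x,
  enorm (x - xs) < tau -> edist_to (crit res) x = enorm (x - xs).
Proof.
have [tau tau0 tauP] := crit_isolated.
(* Half the isolation radius: a critical point other than [xs] is at least tau away from [xs], hence
   at least tau / 2 away from x. *)
exists (tau / 2); first by rewrite divr_gt0.
move=> x xtau; apply/le_anti; rewrite edist_to_xs_le /=.
apply: lb_le_inf; first by exists (enorm (x - xs)); exists xs.
move=> _ [z gz <-]; have [ztau|ztau] := ltP (enorm (z - xs)) tau.
  by rewrite (tauP z).
have : enorm (z - xs) <= enorm (x - z) + enorm (x - xs).
  have -> : z - xs = (z - x) + (x - xs) by rewrite addrA subrK.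
  by rewrite (enormBC x z) ler_enormD.
by lra.
Qed.

Hypothesis error_bound : forall x, eball xs r x ->
  omega * edist_to (crit res) x <= enorm (grad res x).

(** The error bound is applied at xs + t v for small t: the distance to the critical set is then t
    |v|, and the gradient is t Js^T Js v up to order 1 + delta. *)
Lemma omega_le (v : 'cV[R]_n) : omega * enorm v <= enorm (Js^T *m Js *m v).
Proof.
have [->|v0] := eqVneq v 0; first by rewrite mulmx0 !enorm0 mulr0.
rewrite -enorm_gt0 in v0; rewrite leNgt; apply/negP => gap.
have [tau tau0 tauP] := edist_to_xs_near.
pose C := 2 * L * L2 + sigma.
have C0 : 0 <= C by rewrite !(mulr_ge0, addr_ge0).
(* Chosen so that the remainder C |v| e falls short of the supposed gap, which equals e (C |v| +
   1). *)
pose e := (omega * enorm v - enorm (Js^T *m Js *m v)) / (C * enorm v + 1).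
have Cv : 0 < C * enorm v + 1 by rewrite ltr_wpDl ?mulr_ge0 ?enorm_ge0.
have e0 : 0 < e by rewrite divr_gt0 // subr_gt0.
have [b b0 bP] := powR_small delta_gt0 e0.
(* The length of t v: it keeps xs + t v in the ball, makes the distance formula valid, and gives
   s^delta <= e. *)
pose s := Num.min (Num.min (r / 2) (tau / 2)) b.
have s0 : 0 < s by rewrite !lt_min b0 !divr_gt0.
have sr : s < r by rewrite !gt_min ltr_pdivrMr ?ltr_pMr ?ltr1n.
have st : s < tau by rewrite !gt_min [tau / 2 < _]ltr_pdivrMr ?ltr_pMr ?ltr1n ?orbT.
have sb : s <= b by rewrite ge_min lexx orbT.
pose t := s / enorm v.
have t0 : 0 < t by rewrite divr_gt0.
have tv : enorm (t *: v) = s.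
  by rewrite enormZ ger0_norm ?ltW // /t divfK ?gt_eqF.
have tr : enorm (t *: v) < r by rewrite tv.
have := error_bound (ball_add tr); rewrite tauP; last by rewrite addl_subK tv.
have -> : xs + t *: v - xs = t *: v by rewrite addl_subK.
have h := grad_taylor tr.
set g := grad _ _ in h *; set A := Js^T *m Js in h gap e e0 bP *.
have := ler_enormD (g - A *m (t *: v)) (A *m (t *: v)); rewrite subrK => h2.
move=> /le_trans/(_ h2); move: h; rewrite -/C -scalemxAr !enormZ (ger0_norm (ltW t0)).
rewrite {2}(_ : t * enorm v = s); last by rewrite /t divfK ?gt_eqF.
set p := enorm (g - _) => h h3.
have se : s `^ delta <= e by apply: bP; rewrite ltW.
have h4 : t * (omega * enorm v - enorm (A *m v)) <= t * (C * enorm v * e).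
  have : C * (t * enorm v * s `^ delta) <= C * (t * enorm v * e).
    by rewrite !ler_wpM2l // mulr_ge0 ?enorm_ge0 // ltW.
  lra.
rewrite ler_pM2l // in h4; move: h4.
have -> : omega * enorm v - enorm (A *m v) = e * (C * enorm v + 1).
  by rewrite /e divfK // gt_eqF.
by rewrite mulrDr mulr1 [e * _]mulrC gerDl leNgt e0.
Qed.

(** An eigenvector for the smallest eigenvalue [lam] turns the norm bound [omega_le] into omega <=
    lam. *)
Lemma omega_le_quad (v : 'cV[R]_n) : omega * dotv v v <= dotv v (Js^T *m Js *m v).
Proof.
have [->|v0] := eqVneq v 0; first by rewrite mulmx0 !dotv0r mulr0.
have n0 := col_neq0_dim v0.
have [|u|lam [evl lam0 lamP]] := @psd_min_eigenvalue _ _ (Js^T *m Js) n0.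
- by rewrite trmx_mul trmxK.
- by rewrite -mulmxA -dotv_mull dotv_ge0.
apply: le_trans (lamP v); apply: ler_wpM2r; first exact: dotv_ge0.
case/eigenvalueP: evl => w wA w0.
have := omega_le w^T; have -> : Js^T *m Js *m w^T = lam *: w^T.
  apply: trmx_inj; rewrite trmx_mul [(Js^T *m Js)^T]trmx_mul !trmxK wA.
  by rewrite linearZ /= trmxK.
rewrite enormZ ger0_norm // ler_pM2r // enorm_gt0.
by apply: contra w0 => /eqP/(congr1 trmx); rewrite trmxK trmx0 => ->.
Qed.

(** Pairing [step_identity] with w = u + d exploits the coercivity of mu I + Js^T Js and leaves a
    factor |w| to cancel. [kap] bounds the relative residual of the inner iteration. *)
Lemma step_bound u d mu kap c1 : enorm u < r ->
  0 <= mu -> 0 <= kap -> 0 <= c1 -> enorm d <= c1 * enorm u ->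
  let J := jac res (xs + u) in
  enorm (grad res (xs + u) + (J^T *m J *m d + mu *: d))
    <= kap * enorm (grad res (xs + u)) ->
  (mu + omega) * enorm (u + d) <=
  (mu + (kap * (L2 ^+ 2 + L * Rmax) + sigma * enorm u `^ delta
     + L * L2 * (1 + c1) * enorm u)) * enorm u
  + L * L2 * enorm u * enorm (u + d).
Proof.
move=> ur mu0 kap0 c10 dc J he; set w := u + d; set rhs := (X in _ <= X).
have a0 := enorm_ge0 u; have w0 := enorm_ge0 w.
have Rmax0 : 0 <= Rmax by apply: le_trans (resRmax ball_xs); exact: enorm_ge0.
have rhs0 : 0 <= rhs by rewrite /rhs !(addr_ge0, mulr_ge0, powR_ge0, sqr_ge0).
have [->|wn0] := eqVneq (enorm w) 0; first by rewrite mulr0.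
have wp : 0 < enorm w by rewrite lt_neqAle eq_sym wn0.
rewrite -(ler_pM2l wp).
apply: (@le_trans _ _ (dotv w (mu *: w + Js^T *m Js *m w))).
  rewrite dotvDr dotvZr -enorm_sqr.
  by have := omega_le_quad w; rewrite -enorm_sqr; lra.
apply: le_trans (dotv_le _ _) _; rewrite ler_pM2l //.
have := step_identity J Js mu (res (xs + u) - res xs) u d ((J - Js)^T *m res xs).
rewrite -/w -grad_splitE => ->.
have h1 : enorm (mu *: u) <= mu * enorm u by rewrite enormZ ger0_norm.
have h2 : enorm (grad res (xs + u) + (J^T *m J *m d + mu *: d))
    <= kap * ((L2 ^+ 2 + L * Rmax) * enorm u).
  by apply: le_trans he _; rewrite ler_wpM2l // enorm_grad_le.
have h3 := jac_sigma_xs ur.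
have h4 : enorm (J^T *m (res (xs + u) - res xs - Js *m u + (J - Js) *m d))
    <= L2 * (L * enorm u ^+ 2 + L * enorm u * (c1 * enorm u)).
  apply: enorm_trmulmx_le; first exact/jacL2/ball_add.
  apply: le_trans (ler_enormD _ _) (lerD (res_taylor u) _).
  by apply: enorm_mulmx_le dc; exact: jac_lip_xs.
have h5 : enorm ((J - Js)^T *m (Js *m w)) <= L * enorm u * (L2 * enorm w).
  apply: enorm_trmulmx_le; first exact: jac_lip_xs.
  by apply: enorm_mulmx_le => //; exact/jacL2/ball_xs.
apply: le_trans (ler_enormB _ _) _.
have h6 := ler_enormB (mu *: u + (grad res (xs + u) + (J^T *m J *m d + mu *: d))
  - (J - Js)^T *m res xs) (J^T *m (res (xs + u) - res xs - Js *m u + (J - Js) *m d)).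
have h7 := ler_enormB (mu *: u + (grad res (xs + u) + (J^T *m J *m d + mu *: d)))
  ((J - Js)^T *m res xs).
have h8 := ler_enormD (mu *: u) (grad res (xs + u) + (J^T *m J *m d + mu *: d)).
(* Five summands in the order of the terms of [step_identity], to match the nested triangle
   inequalities. *)
have -> : rhs = mu * enorm u + kap * ((L2 ^+ 2 + L * Rmax) * enorm u)
    + sigma * (enorm u * enorm u `^ delta)
    + L2 * (L * enorm u ^+ 2 + L * enorm u * (c1 * enorm u))
    + L * enorm u * (L2 * enorm w) by rewrite /rhs; ring.
rewrite lerD // (le_trans h6) // lerD // (le_trans h7) // lerD //
  (le_trans h8) // lerD //.
Qed.

End CriticalPoint.

(** * The PILM direction, and nondegeneracy from (E6) *)

(** The first inner iterate is one pass started from 0, so the direction is the result of [l] passes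
    from 0. *)
Lemma pilm_residual (R : realType) n m (res : 'cV[R]_n -> 'cV[R]_m) Pi x mu l :
  finset.partition Pi [set: 'I_n]%SET -> differentiable res x -> 0 < mu ->
  (1 <= l)%N ->
  let d := pilm_dir res Pi x mu l in
  enorm (grad res x + ((jac res x)^T *m jac res x *m d + mu *: d))
    <= pilm_rho res Pi x mu ^+ l * enorm (grad res x).
Proof.
move=> hPi dres mu0 l0.
have Pu := psd_addmu_unit mu0 (Pmat_psd res hPi x).
have := iter_residual_le (Bmat res Pi x) (grad res x) l Pu.
rewrite -[l in iter l](prednK l0) iterSr mulmx0 addr0 => h.
apply: le_trans h; rewrite (jacTjacE hPi dres).
rewrite !mulmxDl mul_scalar_mx addrAC; exact: lexx.
Qed.

(** On the kernel P v = - B v, so a nonzero v would make the smallest eigenvalue of P at most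
    |B|. *)
Lemma crit_nondegenerate (R : realType) n m (res : 'cV[R]_n -> 'cV[R]_m) Pi x
    (v : 'cV[R]_n) :
  finset.partition Pi [set: 'I_n]%SET -> differentiable res x ->
  spectral_norm (Bmat res Pi x) < lambda_min (Pmat res Pi x) ->
  (jac res x)^T *m jac res x *m v = 0 -> v = 0.
Proof.
move=> hPi dres BP; rewrite (jacTjacE hPi dres) mulmxDl => PBv.
apply/eqP; apply: contraT => v0.
have n0 := col_neq0_dim v0.
have [lam [evl lam0 lamP]] :=
  psd_min_eigenvalue n0 (trmx_Pmat res hPi x) (Pmat_psd res hPi x).
have lamin : lambda_min (Pmat res Pi x) <= lam.
  apply: ge_inf; first by exists 0 => _ [a _ <-].
  by exists lam => //; rewrite ger0_norm.
have : lam * dotv v v <= spectral_norm (Bmat res Pi x) * dotv v v.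
  apply: le_trans (lamP v) _.
  have -> : Pmat res Pi x *m v = - (Bmat res Pi x *m v).
    by apply/eqP; rewrite -addr_eq0 PBv.
  apply: le_trans (dotv_le _ _) _; rewrite enormN -enorm_sqr expr2 mulrCA.
  by rewrite ler_wpM2l ?enorm_ge0 ?enorm_mulmx.
rewrite ler_pM2r; last by rewrite -enorm_sqr exprn_gt0 ?enorm_gt0.
by move=> h; have := lt_le_trans BP lamin; rewrite ltNge h.
Qed.

End Auxiliary.

Theorem theorem3p3 (R : realType) (n m : nat)
  (Pi : {set {set 'I_n}}) (hPi : finset.partition Pi [set: 'I_n]%SET)
  (res : 'cV[R]_n -> 'cV[R]_m)
  (xstar : 'cV[R]_n) (hxstar : crit res xstar)
  (r : R) (hr0 : 0 < r) (hr1 : r < 1)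
  (Rmax L L1 L2 L3 L4 : R) (hRmax0 : 0 <= Rmax) (hL20 : 0 <= L2)
  (hRmax : forall x, eball xstar r x -> enorm (res x) <= Rmax)
  (hL2 : forall x, eball xstar r x -> spectral_norm (jac res x) <= L2)
  (hL1 : L1 = L) (hL3 : L3 = L2 ^+ 2 + L1 * Rmax) (hL4 : L4 = L1 * L2 / 2)
  (E2 : continuously_differentiable res)
  (E3 : forall x y : 'cV[R]_n,
     spectral_norm (jac res x - jac res y) <= L * enorm (x - y))
  (omega : R) (homega : 0 < omega)
  (E4 : forall x, eball xstar r x ->
     omega * edist_to (crit res) x <= enorm ((jac res x)^T *m res x))
  (sigma delta : R) (hsigma : 0 < sigma) (hdelta0 : 0 < delta)
  (hdelta1 : delta <= 1)
  (E5 : forall x z, eball xstar r x -> eball xstar r z -> crit res z ->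
     enorm ((jac res x - jac res z)^T *m res z)
       <= sigma * enorm (x - z) `^ (1 + delta))
  (E6 : forall x, eball xstar r x ->
     spectral_norm (Bmat res Pi x) < lambda_min (Pmat res Pi x))
  (x : nat -> 'cV[R]_n) (mu : nat -> R) (ell : nat -> nat)
  (hx : pilm_full_steps res Pi x mu ell)
  (xproj : nat -> 'cV[R]_n)
  (hxproj : forall k, crit res (xproj k) /\
     enorm (x k - xproj k) = edist_to (crit res) (x k))
  (m_mu M_mu : R) (hm_mu : 0 < m_mu) (hM_mu : m_mu <= M_mu)
  (hmu : forall k, m_mu * enorm (x k - xproj k) `^ delta <= mu k
                   <= M_mu * enorm (x k - xproj k) `^ delta)
  (Ceta : R) (hCeta : 0 <= Ceta)
  (hell : forall k, pilm_rho res Pi (x k) (mu k) ^+ ell k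
                    <= Ceta * enorm (x k - xproj k) `^ delta)
  (c1 : R) (hc10 : 0 <= c1)
  (hc1 : forall k, eball xstar r (x k) ->
     enorm (pilm_dir res Pi (x k) (mu k) (ell k))
       <= c1 * edist_to (crit res) (x k))
  (c2 c3 : R)
  (hc2 : c2 = L4 * c1 ^+ 2 + L1 * L2 * (1 + c1) + L1 * L2 * (1 + c1) ^+ 2)
  (hc3 : c3 = c2 + sigma + sigma * (1 + c1) `^ (1 + delta) + L3 * Ceta
              + c1 * M_mu)
  (nu : R) (hnu0 : 0 < nu) (hnu1 : nu < 1)
  (eps : R) (heps0 : 0 < eps)
  (heps : eps <= Num.min ((omega * nu / c3) `^ (1 / delta))
                         (r * (1 - nu) / (1 + c1 - nu)))
  (hx0 : eball xstar eps (x 0%N)) :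
  [/\ (fun k => edist_to (crit res) (x k)) @ \oo --> (0 : R),
      exists xbar : 'cV[R]_n,
        [/\ crit res xbar, eball xstar r xbar & x @ \oo --> xbar],
      delta < 1 -> superlinear (fun k => edist_to (crit res) (x k))
    & delta = 1 -> quadratic (fun k => edist_to (crit res) (x k))].
Proof.
have dres y : differentiable res y by case: E2.
have d0_le1 : 0 <= delta by exact: ltW.
set h := fun k => edist_to (crit res) (x k).
set a := fun k => enorm (x k - xstar).
have a_ge0 k : 0 <= a k by exact: enorm_ge0.
have h_le_a k : h k <= a k by exact: edist_to_xs_le.
(* Since mu k > 0 is at most [M_mu] times a positive power of the distance, no iterate is critical.
   The rates below divide by [h k]. *)
have h_gt0 k : 0 < h k.
  have [_ hk] := hxproj k; rewrite /h -hk lt_neqAle enorm_ge0 andbT eq_sym.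
  apply/eqP => h0; have [mu0 _ _] := hx k; have /andP[_] := hmu k.
  by rewrite h0 powR0 ?gt_eqF // mulr0 leNgt mu0.
(* (E3) is used at two points a positive distance apart, [x 0] and its projection. *)
have L_ge0 : 0 <= L.
  have := le_trans (spectral_norm_ge0 _) (E3 (x 0%N) (xproj 0%N)).
  by rewrite pmulr_lge0 // (hxproj 0%N).2; exact: h_gt0.
have M_gt0 : 0 < M_mu by exact: lt_le_trans hM_mu.
have sigma_ge0 : 0 <= sigma by exact: ltW.
have xs_ball : eball xstar r xstar by exact: ball_xs.
have nondeg v := @crit_nondegenerate _ _ _ _ _ _ v hPi (dres xstar) (E6 _ xs_ball).
have L3_ge0 : 0 <= L3 by rewrite hL3 hL1 addr_ge0 ?sqr_ge0 ?mulr_ge0.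
have LL2 : 0 <= L * L2 by exact: mulr_ge0.
have c1M : 0 <= c1 * M_mu by rewrite mulr_ge0 // ltW.
have sc : 0 <= sigma * (1 + c1) `^ (1 + delta) by rewrite mulr_ge0 ?powR_ge0.
have LC : 0 <= L3 * Ceta by exact: mulr_ge0.
(* [C1] collects the coefficients in [s1] once each factor is bounded by [a k] to the power delta;
   [L * L2] is that of the remaining term, and both fit under [c3]. *)
pose C1 := Ceta * L3 + sigma + L * L2 * (1 + c1).
have C1_ge0 : 0 <= C1 by rewrite /C1 !addr_ge0 ?mulr_ge0 // addr_ge0.
have C1c3 : C1 + L * L2 <= c3.
  have q1 : 0 <= L * L2 * c1 by rewrite mulr_ge0.
  have q2 : 0 <= L * L2 * c1 ^+ 2 by rewrite mulr_ge0 // sqr_ge0.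
  by rewrite hc3 hc2 hL4 hL1 /C1; lra.
have c3_gt0 : 0 < c3.
  by apply: lt_le_trans C1c3; rewrite /C1; have := mulr_ge0 LL2 hc10; lra.
have eps_r : eps <= r.
  apply: le_trans heps _; rewrite ge_min; apply/orP; right.
  by rewrite ler_pdivrMr ?ler_pM2l; lra.
have nu1 : 0 < nu < 1 by rewrite hnu0.
(* This is the first term of the minimum bounding [eps], raised to the power delta. *)
have powR_budget k : a k < eps -> c3 * a k `^ delta <= omega * nu.
  move=> ak; rewrite -ler_pdivlMl // mulrC.
  have q0 : 0 <= omega * nu / c3 by rewrite divr_ge0 ?mulr_ge0 // ltW.
  rewrite -[leRHS](powRr1 q0) -(mulVf (lt0r_neq0 hdelta0)) -[delta^-1]div1r powRrM.
  apply: ge0_ler_powR; rewrite ?nnegrE ?powR_ge0 //.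
  by apply: le_trans (ltW ak) _; apply: le_trans heps _; rewrite ge_min lexx.
(* A factor independent of k: [a k <= 1] gives [mu k <= M_mu]. *)
pose theta := (M_mu + omega) / (M_mu + omega + (1 - nu) * omega).
have step k : a k < eps -> a k.+1 <= theta * a k /\
    (1 - nu) * omega * a k.+1 <= (M_mu + C1) * a k `^ delta * a k.
  move=> ak; have [mu0 ell0 xk1] := hx k; have /andP[_ muM] := hmu k.
  set d := pilm_dir _ _ _ _ _ in xk1.
  have aku : enorm (x k - xstar) < r by exact: lt_le_trans eps_r.
  have xE : x k = xstar + (x k - xstar) by rewrite addrC subrK.
  have a1 : a k <= 1 by apply/ltW/(lt_trans _ hr1).
  have ap : a k <= a k `^ delta by rewrite ler_powR_self // a_ge0.
  have p1 : a k `^ delta <= 1.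
    apply: (@le_trans _ _ (1 `^ delta)); last by rewrite powR1.
    by rewrite ge0_ler_powR // nnegrE.
  have hp : h k `^ delta <= a k `^ delta.
    by rewrite ge0_ler_powR // nnegrE // ltW.
  have p_ge0 : 0 <= a k `^ delta by exact: powR_ge0.
  rewrite (hxproj k).2 -/(h k) in muM.
  have muMp : mu k <= M_mu * a k `^ delta.
    by apply: le_trans muM _; rewrite ler_pM2l.
  have muM1 : mu k <= M_mu by apply: le_trans muMp _; rewrite ler_piMr // ltW.
  set kap := pilm_rho res Pi (x k) (mu k) ^+ ell k.
  have kap0 : 0 <= kap by rewrite exprn_ge0 // spectral_norm_ge0.
  have kapP : kap <= Ceta * a k `^ delta.
    apply: le_trans (hell k) _; rewrite (hxproj k).2 -/(h k).
    by rewrite ler_wpM2l.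
  have dc : enorm d <= c1 * enorm (x k - xstar).
    apply: le_trans (hc1 _ aku) _.
    by rewrite ler_wpM2l //; exact: h_le_a.
  have res_k := pilm_residual (l := ell k) hPi (dres (x k)) mu0 ell0.
  rewrite -/d -/kap {1 2 3 4}xE in res_k.
  have b := step_bound dres hxstar L_ge0 hL20 sigma_ge0 hdelta0 hdelta1 hr0 hr1
    hRmax hL2 E3 E5 nondeg E4 aku (ltW mu0) kap0 hc10 dc res_k.
  have xk1E : x k - xstar + d = x k.+1 - xstar by rewrite xk1 addrAC.
  rewrite xk1E -/(a k) -/(a k.+1) -hL1 -hL3 hL1 in b.
  set s1 := kap * L3 + _ + _ in b.
  have s1p : s1 <= C1 * a k `^ delta.
    have q1 := ler_wpM2r L3_ge0 kapP.
    have q2 : L * L2 * (1 + c1) * a k <= L * L2 * (1 + c1) * a k `^ delta.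
      by rewrite ler_wpM2l // mulr_ge0 // addr_ge0.
    by rewrite /s1 /C1; lra.
  have s2p : L * L2 * a k <= L * L2 * a k `^ delta by rewrite ler_wpM2l.
  have s10 : 0 <= s1.
    by rewrite /s1 !addr_ge0 ?mulr_ge0 // addr_ge0.
  have s12 : s1 + L * L2 * a k <= omega * nu.
    apply: le_trans (powR_budget _ ak).
    apply: (@le_trans _ _ ((C1 + L * L2) * a k `^ delta)); first by lra.
    by rewrite ler_wpM2r.
  have [r1 r2] := contraction_of_bound homega nu1 (a_ge0 k) (a_ge0 k.+1) s10
    (mulr_ge0 LL2 (a_ge0 k)) mu0 muM1 s12 b.
  split=> //; apply: le_trans r2 _; rewrite ler_wpM2r //; lra.
have den_gt0 : 0 < (1 - nu) * omega by rewrite mulr_gt0 ?subr_gt0.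
have th_gt0 : 0 < theta by rewrite divr_gt0 ?addr_gt0.
have th_lt1 : theta < 1.
  by rewrite ltr_pdivrMr ?mul1r ?ltrDl // !addr_gt0.
(* The contraction keeps the iterates in the ball of radius [eps], so [step] applies again. *)
have a_eps k : a k < eps.
  elim: k => [|k IH] //; have [ak1 _] := step k IH.
  apply: le_lt_trans ak1 (le_lt_trans _ IH).
  by rewrite ler_piMl // ltW.
have a_geo k : a k <= a 0%N * theta ^+ k.
  elim: k => [|k IH]; first by rewrite expr0 mulr1.
  apply: le_trans (step k (a_eps k)).1 _.
  by rewrite exprS mulrCA ler_pM2l.
have a_cvg : a @ \oo --> (0 : R).
  apply: (@squeeze_cvgr _ _ _ _ (fun=> 0) (geometric (a 0%N) theta)).
  - by near=> k; rewrite a_ge0 a_geo.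
  - exact: cvg_cst.
  - by apply: cvg_geometric; rewrite gtr0_norm.
have h_cvg : h @ \oo --> (0 : R).
  apply: (@squeeze_cvgr _ _ _ _ (fun=> 0) a) => //; last exact: cvg_cst.
  by near=> k; rewrite h_le_a ltW.
pose C := (M_mu + C1) / ((1 - nu) * omega).
have C_ge0 : 0 <= C by rewrite divr_ge0 ?(ltW den_gt0) // addr_ge0 // ltW.
(* For large k the distance to the critical set is [a k], so the estimate of [step] can be read in
   terms of [h k]; at the next index [h_le_a] suffices. *)
have h_near : \forall k \near \oo, h k.+1 <= C * h k `^ delta * h k.
  have [tau tau0 tauP] := edist_to_xs_near dres hxstar L_ge0 hL20 sigma_ge0
    hdelta0 hdelta1 hr0 hr1 hL2 E3 E5 nondeg.
  near=> k.
  have ak : a k < tau.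
    rewrite (le_lt_trans (ler_norm _)) //; near: k.
    exact: cvgr0_norm_lt a_cvg _ tau0.
  have -> : h k = a k by exact: tauP.
  apply: le_trans (h_le_a _) _; rewrite /C -!mulrA mulrCA.
  rewrite -(ler_pM2l den_gt0); apply: le_trans (step k (a_eps k)).2 _.
  by rewrite mulVKf ?gt_eqF // mulrA.
split=> //.
(* The limit is the given critical point itself. *)
- exists xstar; split=> //; apply/cvgrPdist_le => e e0; near=> k.
  rewrite distrC; apply: le_trans (mx_norm_le_enorm _) _.
  apply: le_trans (ler_norm _) _; near: k.
  exact: cvgr0_norm_le a_cvg _ e0.
- by move=> _; exact: superlinear_of_eventual h_near.
- move=> d1; apply: (quadratic_of_eventual C_ge0) => //.
  near=> k; rewrite expr2 mulrA -[X in C * X * _](powRr1 (ltW (h_gt0 k))) -d1.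
  by near: k.
Unshelve. all: by end_near.
Qed.
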